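(* Let $T>0$, let $\omega\colon[0,T]\to\mathbb R$ be a continuous function with $\omega_0=0$, and let $b\colon\mathbb R\to\mathbb R$ be a measurable function satisfying: (H1) $b(0)=0$; (H2) $b$ is non-decreasing on $(0,\infty)$; (H3) $b$ is continuous on $[0,\infty)$, and of class $C^1$ with $b'$ non-increasing on $(0,\infty)$; (H4) $b(|x|)\le b(-|x|)$ for all $x\in\mathbb R$; (H5) $b$ is non-increasing on $(-\infty,0]$. Let $y$ be a solution of the equation $$y_t=\int_0^t b(y_s+\omega_s)\,ds,\qquad t\in[0,T].$$ Assume that the function $$a(t)=\mathbf 1_{\{\omega_t\ge 0\}}\cdot b'\Big(\Big(\omega_t+\int_0^t\mathbf 1_{\{\omega_s>0\}}b(\omega_s)\,ds\Big)+\Big)+\mathbf 1_{\{\omega_t<0\}}\cdot b'\big(|y_t+\omega_t|+\big)$$ belongs to $L^1([0,T])$. Let $\bar y$ be another solution of the same equation, with $y\le\bar y$ on $[0,T]$. Then $y=\bar y$.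
   Context: A solution is a continuous function $y\colon[0,T]\to\mathbb R$ satisfying the integral equation for all $t\in[0,T]$. For $z\ge0$, $b'(z+):=\lim_{x\downarrow z}b'(x)$ (right-limit at the point $z$); $b'(0+)$ may be $+\infty$. In the formula for $a(t)$, the trailing ''+'' inside $b'(\,\cdot\,+)$ denotes this right-limit, $\mathbf 1$ denotes an indicator function, and the convention $0\cdot\infty=0$ is used. *)

(* Defs.v *)
From HB Require Import structures.
From mathcomp Require Import all_boot all_order all_algebra.
From mathcomp Require Import all_classical all_reals all_analysis.
Set Implicit Arguments.
Unset Strict Implicit.
Unset Printing Implicit Defensive.
Import Order.TTheory GRing.Theory Num.Theory.
Import numFieldNormedType.Exports.
Local Open Scope classical_set_scope.
Local Open Scope ring_scope.

(* Functions on [0, T] are represented by total functions R -> R of which only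
   the values on `[0, T] are ever used. *)

(* The integral is taken in \bar R: as the left-hand side is finite, the
   equation forces the integral to be finite, which would not be the case with
   the real-valued Rintegral. *)
Definition is_solution (R : realType) (T : R) (b w y : R -> R) : Prop :=
  {within `[0, T], continuous y} /\
  forall t : R, t \in `[0, T] ->
    (y t)%:E = (\int[@lebesgue_measure R]_(s in `[0%R, t]) (b (y s + w s)%R)%:E)%E.

(* b'(z+), as an extended real because b'(0+) may be +oo. *)
Definition right_lim_deriv (R : realType) (b : R -> R) (z : R) : \bar R :=
  lim ((b^`()%classic x)%:E @[x --> z^'+]).

(* Multiplication on \bar R satisfies 0 * +oo = 0. *)
Definition coef_a (R : realType) (b w y : R -> R) (t : R) : \bar R :=
  ((\1_[set s | (0 <= w s)%R] t)%:E *
     right_lim_deriv b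
       (w t + \int[@lebesgue_measure R]_(s in `[0, t])
                (\1_[set r | 0 < w r] s * b (w s)))%R
   + (\1_[set s | (w s < 0)%R] t)%:E * right_lim_deriv b `|y t + w t|%R)%E.

(* Main.v *)
Require Import Defs.
From HB Require Import structures.
From mathcomp Require Import all_boot all_order all_algebra.
From mathcomp Require Import all_classical all_reals all_analysis.
From mathcomp Require Import measurable_realfun ring lra.
Import Order.TTheory GRing.Theory Num.Theory.
Import numFieldNormedType.Exports.
Local Open Scope classical_set_scope.
Local Open Scope ring_scope.

(** Write d = ybar - y >= 0.  The theorem follows from the pointwise bound

      b (ybar_t + w_t) - b (y_t + w_t) <= a t * d t        (coef_a_bound)

    because integrating it gives d t <= int_0^t a d with a nonnegative and
    integrable, and Gronwall's argument (gronwall_eq0) then forces d = 0.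

    The pointwise bound comes from the concavity of b on the half-line: for
    0 <= z <= x <= x', the mean value theorem gives
    b x' - b x <= b'(z+) (x' - x) (increment_le_right_lim_deriv).

    - Where w_t >= 0, one takes x = y_t + w_t and
      z = w_t + int_0^t 1_{w > 0} b(w).  That z <= x holds because b is
      nonnegative and y is therefore nonnegative: where w_s > 0, the
      monotonicity of b gives b (y_s + w_s) >= b (w_s), so y_t, the integral of
      the left-hand side, dominates the integral in z
      (integral_drift_le_solution).

    - Where w_t < 0, the point x = y_t + w_t may be negative.  The drift on the
      left of 0 is nonincreasing and dominates its reflection b |x|, hence b
      cannot grow between x and x' unless x' > |x|, and then
      b x' - b x <= b x' - b |x| <= b'(|x|+) (x' - |x|) <= b'(|x|+) (x' - x)
      (increment_le_right_lim_deriv_norm).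

    An infinite value of b'(0+) is harmless in these bounds: it is multiplied
    by x' - x, and when the latter vanishes so does the increment of b. *)

(** * Gronwall's lemma with an integrable coefficient *)

(** Extending f by 0 outside D, the set function A |-> int_A |f| is a finite
    charge dominated by mu, so this is the epsilon-delta form of domination. *)
Lemma integral_abse_abs_continuous {d} {X : measurableType d} {R : realType}
    (mu : {measure set X -> \bar R}) (D : set X) (f : X -> \bar R) (e : R) :
  mu.-integrable D f -> measurable D -> 0 < e ->
  exists2 r : R, 0 < r & forall A, measurable A -> A `<=` D ->
    (mu A < r%:E)%E -> (\int[mu]_(x in A) `|f x| < e%:E)%E.
Proof.
move=> intf mD e0.
have intfT : mu.-integrable setT (f \_ D) by exact: (integrable_mkcond _ _).1 intf.
have [P [N pn]] := Hahn_decomposition (induced_charge (integrable_abse intfT)).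
have [r [r0 small]] :=
  charge_variation_continuous pn (dominates_induced intfT) e0.
exists r => // A mA AD /(small _ mA); apply: le_lt_trans.
apply: (le_trans _ (abse_charge_variation pn mA)).
rewrite [leRHS]gee0_abs; last by apply: integral_ge0 => x _ /=.
rewrite le_eqVlt; apply/orP; left; apply/eqP/eq_integral => x /set_mem Ax.
by rewrite /= patchT// inE; exact: AD.
Qed.

Section gronwall.
Local Notation mu := lebesgue_measure.

(** The coefficient a may take the value +oo, so no exponential of its
    primitive is used.  Instead, absolute continuity of the integral yields a
    length r such that a has integral less than 1/2 over every interval shorter
    than r.  If f vanishes up to u and c maximizes f on [0, v] with v - u < r,
    then f c <= f c * int_u^c a <= f c / 2, so that f vanishes up to v; finitely
    many steps of length r / 2 cover [0, T]. *)
Lemma gronwall_eq0 {R : realType} (T : R) (a : R -> \bar R) (f : R -> R) :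
  mu.-integrable `[0, T] a ->
  (forall t : R, t \in `[0, T] -> (0 <= a t)%E) ->
  {within `[0, T], continuous f} ->
  (forall t : R, t \in `[0, T] -> 0 <= f t) ->
  (forall t : R, t \in `[0, T] ->
    ((f t)%:E <= \int[mu]_(s in `[0%R, t]) (a s * (f s)%:E))%E) ->
  forall t : R, t \in `[0, T] -> f t = 0.
Proof.
move=> inta a0 cf f0 flea.
have half_gt0 : 0 < 2^-1 :> R by rewrite invr_gt0.
have [r r0 small] :=
  integral_abse_abs_continuous _ _ _ _ inta (measurable_itv _) half_gt0.
have ma := measurable_int _ inta.
have mf := subspace_continuous_measurable_fun (measurable_itv `[0, T]) cf.
have maf : measurable_fun `[0, T] (fun s => a s * (f s)%:E)%E.
  by apply: emeasurable_funM => //; exact/measurable_EFinP.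
have sub (i : interval R) t : t \in `[0, T] -> (i <= `[0%R, t])%O ->
    [set` i] `<=` `[0, T].
  rewrite in_itv/= => /andP[_ tT] it x /(subitvP it).
  by rewrite /= !in_itv/= => /andP[-> /le_trans]; exact.
have step u v : 0 <= u -> v \in `[0, T] -> v - u < r ->
    (forall s, s \in `[0, T] -> s <= u -> f s = 0) -> f v = 0.
  move=> u0 vT vur fu0.
  move: (vT); rewrite in_itv/= => /andP[v0 vleT].
  have subv : `[0, v] `<=` `[0, T] by exact: sub vT _.
  have cfv : {within `[0, v], continuous f} by exact: continuous_subspaceW cf.
  have [c cv fmax] := EVT_max v0 cfv.
  have cT : c \in `[0, T] by exact: subv.
  suff fc0 : f c = 0.
    apply/eqP; rewrite eq_le f0// andbT -fc0 fmax//.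
    by rewrite in_itv/= v0 lexx.
  have [cu|uc] := leP c u; first exact: fu0.
  have sub0u : `[0, u] `<=` `[0, T].
    by apply: (sub _ c) => //; rewrite subitvE !bnd_simp ltW.
  have subuc : `]u, c] `<=` `[0, T].
    by apply: (sub _ c) => //; rewrite subitvE !bnd_simp u0.
  have itvU : `[0, c]%classic = `[0, u] `|` `]u, c] :> set R.
    by rewrite -itv_bndbnd_setU// bnd_simp// ltW.
  have mucr : (mu (`]u, c]%classic : set R) < r%:E)%E.
    rewrite lebesgue_measure_itv/= lte_fin uc -EFinB lte_fin.
    by move: cv; rewrite in_itv/= => /andP[_ cv]; apply: le_lt_trans vur; rewrite lerB.
  have aint : (\int[mu]_(s in `]u, c]) a s < (2^-1)%:E)%E.
    have := small _ (measurable_itv _) subuc mucr.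
    congr (_ < _)%E; apply: eq_integral => s /set_mem us.
    by rewrite gee0_abs// a0//; exact: subuc.
  have aint0 : (0 <= \int[mu]_(s in `]u, c]) a s)%E.
    by apply: integral_ge0 => s us; apply: a0; exact: subuc.
  have := flea _ cT; rewrite itvU ge0_integral_setU//=; first last.
  - apply/disj_setPS => x/= []; rewrite !in_itv/= => /andP[_ xu] /andP[ux _].
    by move: (lt_le_trans ux xu); rewrite ltxx.
  - move=> x xU; have xT : x \in `[0, T] by case: xU => [/sub0u|/subuc].
    by rewrite mule_ge0 ?a0// lee_fin f0.
  - by rewrite -itvU; apply: measurable_funS maf => //; exact: sub cT _.
  (* f vanishes on [0, u], so only the integral over ]u, c] remains. *)
  rewrite integral0_eq; last first.
    move=> s su; rewrite fu0 ?mule0//; first exact: sub0u.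
    by move: su; rewrite /= in_itv/= => /andP[].
  rewrite add0e => fc.
  have {}fc : ((f c)%:E <= (f c)%:E * \int[mu]_(s in `]u, c]) a s)%E.
    rewrite -ge0_integralZl//; first last.
    - by rewrite lee_fin f0.
    - by move=> s us; rewrite a0//; exact: subuc.
    - exact: measurable_funS ma.
    apply: (le_trans fc); apply: ge0_le_integral => //.
    - move=> s us; have sT : s \in `[0, T] by exact: subuc.
      by rewrite mule_ge0 ?a0// lee_fin f0.
    - exact: measurable_funS maf.
    - by apply: measurable_funeM; exact: measurable_funS ma.
    - move=> s us; have sT : s \in `[0, T] by exact: subuc.
      rewrite muleC lee_wpmul2r ?a0// lee_fin fmax//.
      move: us cv; rewrite /= !in_itv/= => /andP[us sc] /andP[c0 cv].
      by rewrite (le_trans u0 (ltW us))/= (le_trans sc cv).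
  have fc2 : ((f c)%:E <= (f c)%:E * (2^-1)%:E)%E.
    by apply: (le_trans fc); rewrite lee_wpmul2l ?lee_fin ?f0// ltW.
  apply/eqP; rewrite eq_le f0// andbT.
  by move: fc2; rewrite -EFinM lee_fin; lra.
have all0 n t : t \in `[0, T] -> t <= n%:R * (r / 2) -> f t = 0.
  elim: n t => [|n IHn] t tT tn.
    have t0 : t = 0.
      apply/eqP; rewrite eq_le; move: tn tT; rewrite mul0r in_itv/= => ->.
      by case/andP.
    move: (f0 _ tT) (flea _ tT); rewrite t0 set_itv1 integral_set1 lee_fin.
    by move=> f0_ge0 f0_le0; apply/eqP; rewrite eq_le f0_le0.
  apply: (step (n%:R * (r / 2))) => //; first by rewrite mulr_ge0// divr_ge0// ltW.
  by move: tn; rewrite -natr1; nra.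
move=> t tT; apply: (all0 (Num.truncn (t / (r / 2))).+1) => //.
rewrite -ler_pdivrMr ?divr_gt0// ltW//.
by rewrite truncnS_gt.
Qed.

End gronwall.

(** * Increments of a drift that is concave on the half-line *)

Section concave_drift.
Context {R : realType} (b : R -> R).
Context (b0 : b 0 = 0)
  (b_meas : measurable_fun setT b)
  (b_nondec : {in `]0, +oo[ &, {homo b : x z / x <= z}})
  (cb : {within `[0, +oo[, continuous b})
  (db : {in `]0, +oo[, forall x, derivable b x 1})
  (b'_noninc : {in `]0, +oo[ &, {homo b^`()%classic : x z /~ x <= z}})
  (b_norm : forall x : R, b `|x| <= b (- `|x|))
  (b_noninc : {in `]-oo, 0] &, {homo b : x z /~ x <= z}}).

Lemma MVT_halfline (x x' : R) :
  0 <= x -> x < x' ->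
  exists2 c, x < c & b x' - b x = b^`()%classic c * (x' - x).
Proof.
move=> x0 xx'.
have dbx t : t \in `]x, x'[ -> is_derive t 1 b (b^`()%classic t).
  rewrite in_itv/= => /andP[xt _]; rewrite derive1E; apply/derivableP/db.
  by rewrite in_itv/= andbT; exact: le_lt_trans xt.
have cbx : {within `[x, x'], continuous b}.
  apply: continuous_subspaceW cb => t /=.
  by rewrite !in_itv/= andbT => /andP[xt _]; exact: le_trans xt.
have [c + bE] := MVT xx' dbx cbx; rewrite in_itv/= => /andP[xc _].
by exists c.
Qed.

(** Since b' is nonincreasing, b' x is at least the slope of b over
    [x, x + 1]. *)
Lemma derive1_halfline_ge0 (x : R) : 0 < x -> 0 <= b^`()%classic x.
Proof.
move=> x0.
have xx1 : x < x + 1 by rewrite ltrDl.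
have [c xc bE] := MVT_halfline _ _ (ltW x0) xx1.
have pos t : x <= t -> t \in `]0, +oo[.
  by move=> xt; rewrite in_itv/= andbT; exact: lt_le_trans xt.
have : 0 <= b (x + 1) - b x by rewrite subr_ge0 b_nondec ?pos ?lexx// ltW.
rewrite bE addrAC subrr add0r mulr1 => /le_trans; apply.
by rewrite b'_noninc ?pos ?lexx// ltW.
Qed.

(** The point 0 is included because the mean value theorem needs only
    continuity there. *)
Lemma nondecreasing_halfline (x x' : R) :
  0 <= x -> x <= x' -> b x <= b x'.
Proof.
move=> x0; rewrite le_eqVlt => /predU1P[->//|xx'].
have [c xc bE] := MVT_halfline _ _ x0 xx'.
rewrite -subr_ge0 bE mulr_ge0//; last by rewrite subr_ge0 ltW.
by apply: derive1_halfline_ge0 => //; exact: le_lt_trans xc.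
Qed.

(** As b' is nonincreasing, its right limit at z is its supremum over
    ]z, +oo[. *)
Lemma right_lim_deriv_ub (z x : R) :
  0 <= z -> z < x -> ((b^`()%classic x)%:E <= right_lim_deriv b z)%E.
Proof.
move=> z0 zx; rewrite /right_lim_deriv.
have cvg_sup : (b^`()%classic x)%:E @[x --> z^'+] -->
    ereal_sup ((fun x => (b^`()%classic x)%:E) @` `]z, +oo[).
  apply: nonincreasing_at_right_cvge => // u v uz vz uv.
  have pos t : t \in `]z, +oo[ -> t \in `]0, +oo[.
    by rewrite !in_itv/= !andbT; exact: le_lt_trans.
  by rewrite lee_fin b'_noninc// pos.
rewrite (cvg_lim _ cvg_sup)//; apply: ereal_sup_ubound.
by exists x => //=; rewrite in_itv/= zx.
Qed.

Lemma right_lim_deriv_ge0 (z : R) : 0 <= z -> (0 <= right_lim_deriv b z)%E.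
Proof.
move=> z0.
have zz1 : z < z + 1 by rewrite ltrDl.
apply: le_trans (right_lim_deriv_ub _ _ z0 zz1).
by rewrite lee_fin derive1_halfline_ge0// (le_lt_trans z0).
Qed.

(** The increment is b' c * (x' - x) for some c > x >= z.  When x = x' both
    sides are 0, even if the right limit is +oo. *)
Lemma increment_le_right_lim_deriv (z x x' : R) :
  0 <= z -> z <= x -> x <= x' ->
  ((b x' - b x)%:E <= right_lim_deriv b z * (x' - x)%:E)%E.
Proof.
move=> z0 zx; rewrite le_eqVlt => /predU1P[<-|xx'].
  by rewrite !subrr mule0.
have [c xc ->] := MVT_halfline _ _ (le_trans z0 zx) xx'.
rewrite EFinM lee_wpmul2r//; first by rewrite lee_fin subr_ge0 ltW.
by apply: right_lim_deriv_ub => //; exact: le_lt_trans xc.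
Qed.

(** When x < 0, only an increment that ends beyond |x| can be positive: up to 0
    the drift is nonincreasing, and between 0 and |x| it is at most
    b |x| <= b x.  An increment that ends beyond |x| is at most the one from
    |x|. *)
Lemma increment_le_right_lim_deriv_norm (x x' : R) :
  x <= x' ->
  ((b x' - b x)%:E <= right_lim_deriv b `|x| * (x' - x)%:E)%E.
Proof.
move=> xx'.
have [x0|x0] := leP 0 x.
  by apply: increment_le_right_lim_deriv; rewrite ?ger0_norm.
have ge0 : (0 <= right_lim_deriv b `|x| * (x' - x)%:E)%E.
  by rewrite mule_ge0 ?right_lim_deriv_ge0// lee_fin subr_ge0.
have bx : b `|x| <= b x by move: (b_norm x); rewrite (ltr0_norm x0) opprK.
have [x'0|x'0] := leP x' 0.
  apply: le_trans ge0; rewrite lee_fin subr_le0.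
  by rewrite b_noninc ?in_itv//= ltW.
have [x'x|xx'n] := leP x' `|x|.
  apply: le_trans ge0; rewrite lee_fin subr_le0; apply: le_trans bx.
  by apply: nondecreasing_halfline => //; exact: ltW.
apply: (@le_trans _ _ (b x' - b `|x|)%:E); first by rewrite lee_fin lerB.
apply: (@le_trans _ _ (right_lim_deriv b `|x| * (x' - `|x|)%:E)%E).
  by apply: increment_le_right_lim_deriv => //; exact: ltW.
rewrite lee_wpmul2l ?right_lim_deriv_ge0// lee_fin lerB//.
exact: ler_norm.
Qed.

Lemma drift_ge0 (x : R) : 0 <= b x.
Proof.
rewrite -b0.
have [x0|x0] := leP 0 x; first exact: nondecreasing_halfline.
by rewrite b_noninc ?in_itv/= ?lexx// ltW.
Qed.

Local Notation mu := lebesgue_measure.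

(** A solution is nonnegative since its drift is; hence, wherever w is
    positive, b (w s) <= b (y s + w s), and the right-hand side has integral
    y t.  The upper bound also makes the integral on the left finite, so that
    its real value is the extended one. *)
Lemma integral_drift_le_solution (T : R) (w y : R -> R) (t : R) :
  {within `[0, T], continuous w} ->
  is_solution T b w y -> t \in `[0, T] ->
  0 <= \int[mu]_(s in `[0, t]) (\1_[set r | 0 < w r] s * b (w s)) <= y t.
Proof.
move=> cw [cy yE] tT.
have y_ge0 s : s \in `[0, T] -> 0 <= y s.
  move=> sT; rewrite -lee_fin yE//.
  by apply: integral_ge0 => r _; rewrite lee_fin drift_ge0.
have mw := subspace_continuous_measurable_fun (measurable_itv `[0, T]) cw.
have my := subspace_continuous_measurable_fun (measurable_itv `[0, T]) cy.
have subt : `[0, t] `<=` `[0, T].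
  move: tT; rewrite in_itv/= => /andP[_ tT] s /=; rewrite !in_itv/=.
  by move=> /andP[-> /le_trans]; exact.
have ind_ge0 s : 0 <= \1_[set r | 0 < w r] s * b (w s) by rewrite mulr_ge0// drift_ge0.
have int_ge0 : (0 <= \int[mu]_(s in `[0%R, t])
    (\1_[set r | (0 < w r)%R] s * b (w s))%:E)%E.
  by apply: integral_ge0 => s _; rewrite lee_fin.
have int_le : (\int[mu]_(s in `[0%R, t])
    (\1_[set r | (0 < w r)%R] s * b (w s))%:E <= (y t)%:E)%E.
  rewrite yE//; apply: ge0_le_integral => //.
  - by move=> s _; rewrite lee_fin.
  - apply/measurable_EFinP.
    have mw_t : measurable_fun `[0, t] w by exact: measurable_funS mw.
    have -> : (fun s => \1_[set r | 0 < w r] s * b (w s)) =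
        (fun x => \1_(`]0, +oo[%classic) x * b x) \o w.
      apply/funext => s /=; congr (_ * _); rewrite !indicE; congr ((nat_of_bool _)%:R).
      by apply/idP/idP; rewrite !inE/= in_itv/= andbT.
    apply: measurableT_comp => //; apply: measurable_funM => //.
  - apply/measurable_EFinP; apply: measurableT_comp => //.
    by apply: measurable_funD; [exact: measurable_funS my|
                                exact: measurable_funS mw].
  - move=> s st; rewrite lee_fin indicE.
    have [ws|ws] := boolP (s \in [set r | 0 < w r]); last by rewrite mul0r drift_ge0.
    move: ws; rewrite inE/= => ws; rewrite mul1r.
    have ys := y_ge0 _ (subt _ st).
    by rewrite nondecreasing_halfline ?lerDr// ltW.
rewrite /Rintegral fine_ge0//= -lee_fin fineK//.
by rewrite ge0_fin_numE// (le_lt_trans int_le)// ltry.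
Qed.

(** The two indicators select the base point of the increment bound according
    to the sign of w t. *)
Lemma coef_a_bound (T : R) (w y : R -> R) (t x' : R) :
  {within `[0, T], continuous w} ->
  is_solution T b w y -> t \in `[0, T] -> y t <= x' ->
  (0 <= coef_a b w y t)%E /\
  ((b (x' + w t) - b (y t + w t))%:E <= coef_a b w y t * (x' - y t)%:E)%E.
Proof.
move=> cw sol tT yx'.
have := integral_drift_le_solution _ _ _ _ cw sol tT.
rewrite /coef_a; set I := (\int[mu]_(s in _) _) => /andP[I_ge0 I_le].
have -> : x' - y t = x' + w t - (y t + w t) by ring.
rewrite !indicE; have [wt|wt] := leP 0 (w t).
  have -> : (t \in [set s | 0 <= w s]) = true by apply/mem_set.
  have -> : (t \in [set s | w s < 0]) = false.
    by apply/memNset/negP; rewrite -leNgt.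
  rewrite mul1e mul0e adde0; split.
    by apply: right_lim_deriv_ge0 => //; rewrite addr_ge0.
  apply: increment_le_right_lim_deriv => //; first by rewrite addr_ge0.
  - by rewrite addrC lerD2r.
  - by rewrite lerD2r.
have -> : (t \in [set s | 0 <= w s]) = false.
  by apply/memNset/negP; rewrite -ltNge.
have -> : (t \in [set s | w s < 0]) = true by apply/mem_set.
rewrite mul1e mul0e add0e; split; first exact: right_lim_deriv_ge0.
by apply: increment_le_right_lim_deriv_norm; rewrite // lerD2r.
Qed.

End concave_drift.

(** * Comparison of two ordered solutions *)

Theorem theorem2p3 (R : realType) (T : R) (w b y ybar : R -> R)
  (T_gt0 : 0 < T)
  (w_cont : {within `[0, T], continuous w})
  (w0 : w 0 = 0)
  (b_meas : measurable_fun setT b)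
  (H1 : b 0 = 0)
  (H2 : {in `]0, +oo[ &, {homo b : x z / x <= z}})
  (H3_cont : {within `[0, +oo[, continuous b})
  (H3_derivable : {in `]0, +oo[, forall x, derivable b x 1})
  (H3_C1 : {within `]0, +oo[, continuous b^`()%classic})
  (H3_deriv_nonincr : {in `]0, +oo[ &, {homo b^`()%classic : x z /~ x <= z}})
  (H4 : forall x : R, b `|x| <= b (- `|x|))
  (H5 : {in `]-oo, 0] &, {homo b : x z /~ x <= z}})
  (y_sol : is_solution T b w y)
  (a_L1 : (@lebesgue_measure R).-integrable `[0, T] (coef_a b w y))
  (ybar_sol : is_solution T b w ybar)
  (y_le_ybar : forall t : R, t \in `[0, T] -> y t <= ybar t) :
  forall t : R, t \in `[0, T] -> y t = ybar t.
Proof.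
have b_ge0 x : 0 <= b x by exact: drift_ge0.
have increment t : t \in `[0, T] -> (0 <= coef_a b w y t)%E /\
    ((b (ybar t + w t) - b (y t + w t))%:E <=
     coef_a b w y t * (ybar t - y t)%:E)%E.
  by move=> tT; apply: coef_a_bound; rewrite ?y_le_ybar.
have [y_cont yE] := y_sol; have [ybar_cont ybarE] := ybar_sol.
have diff_cont : {within `[0, T], continuous (fun t => ybar t - y t)}.
  by move=> t; apply: cvgB; [exact: ybar_cont|exact: y_cont].
have diff_ge0 t : t \in `[0, T] -> 0 <= ybar t - y t.
  by move=> tT; rewrite subr_ge0 y_le_ybar.
suff diff_eq0 t : t \in `[0, T] -> ybar t - y t = 0.
  by move=> t tT; apply/esym/eqP; rewrite -subr_eq0 diff_eq0.
move: t; apply: (gronwall_eq0 _ _ _ a_L1 _ diff_cont diff_ge0 _).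
  by move=> t /increment[].
move=> t tT.
have subt : `[0, t] `<=` `[0, T].
  move: (tT); rewrite in_itv/= => /andP[_ tleT] s /=; rewrite !in_itv/=.
  by move=> /andP[-> /le_trans]; exact.
have mdrift x : {within `[0, T], continuous x} ->
    measurable_fun `[0, t] (fun s => (b (x s + w s))%:E).
  move=> x_cont; apply/measurable_EFinP; apply: measurableT_comp => //.
  by apply: measurable_funS (measurable_itv _) subt _; apply: measurable_funD;
    exact: subspace_continuous_measurable_fun.
have mcoef : measurable_fun `[0, t] (coef_a b w y).
  exact: measurable_funS (measurable_int _ a_L1).
have mdiff : measurable_fun `[0, t] (fun s => (ybar s - y s)%:E).
  apply/measurable_EFinP.
  apply: measurable_funS (measurable_itv _) subt _.
  exact: subspace_continuous_measurable_fun.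
have prod_ge0 s : `[0, t]%classic s ->
    (0 <= coef_a b w y s * (ybar s - y s)%:E)%E.
  by move=> /subt sT; rewrite mule_ge0 ?lee_fin ?diff_ge0//; case: (increment s).
have mprod : measurable_fun `[0, t]
    (fun s => coef_a b w y s * (ybar s - y s)%:E)%E.
  exact: emeasurable_funM.
have [my mybar] := (mdrift _ y_cont, mdrift _ ybar_cont).
(* Stated without subtraction, the inequality between the integrals is a
   comparison of nonnegative functions, for which measurability suffices. *)
rewrite EFinB leeBlDl// yE// ybarE// -ge0_integralD//=; last first.
  by move=> s _; rewrite lee_fin.
apply: ge0_le_integral => //.
- by move=> s _; rewrite lee_fin.
- exact: emeasurable_funD.
- by move=> s /subt/increment[_]; rewrite EFinB leeBlDl.
Qed.
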